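(* Let $G$ be an infinite discrete group and let $H$ be a finite group with $\#H=c$, acting on $G$ by an affine action $(x,s)\mapsto x^s$. Then the discrete orbit semiconvo $G^H$ is a $0$-Ramsey (recurrent) semiconvo. In particular: (i) if $H$ is a finite subgroup of $G$ with $\#H=c$, the discrete coset semiconvo $G/H$ is a recurrent semiconvo; (ii) if $H$ is a finite subgroup of $G$ with $\#H=c$, the discrete double coset hypergroup $G//H$ is a recurrent hypergroup; (iii) if $H$ is a finite subgroup of the automorphism group of $G$ with $\#H=c$, the discrete automorphism orbit hypergroup $G^H$ is a recurrent hypergroup.
   Context: A map $\varphi:G\to G$ is affine if $\varphi(x)=\psi(x)y$ for some $y\in G$ and automorphism $\psi$ of $G$; an affine action of $H$ on $G$ is an action $(x,s)\mapsto x^s$ such that each $x\mapsto x^s$ is affine. The orbit space $G^H=\{x^H: x\in G\}$, $x^H=\{x^s:s\in H\}$, with discrete topology is a discrete semiconvo under $\delta_{x^H}*\delta_{y^H}=\frac1{c^2}\sum_{s,t\in H}\delta_{(x^sy^t)^H}$. Special cases: $G/H=\{xH\}$ with $\delta_{xH}*\delta_{yH}=\frac1c\sum_{s\in H}\delta_{xsyH}$ (semiconvo); $G//H=\{HxH\}$ with $\delta_{HxH}*\delta_{HyH}=\frac1c\sum_{t\in H}\delta_{HxtyH}$ (hypergroup, identity $H$, involution $HxH\mapsto Hx^{-1}H$); for $H$ a finite group of automorphisms, $G^H$ with $\delta_{x^H}*\delta_{y^H}=\frac1c\sum_{s\in H}\delta_{(x^sy)^H}$ (hypergroup, identity $e^H$,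 involution $x^H\mapsto(x^{-1})^H$). A discrete semiconvo is a set $K$ with a map assigning to $m,n\in K$ a finitely supported probability measure $\delta_m*\delta_n$ (extended bilinearly), associative, with identity element $e_K$ ($\delta_m*\delta_{e_K}=\delta_{e_K}*\delta_m=\delta_m$). For an injective sequence $\langle x_n\rangle$ in $K\setminus\{e_K\}$ with range $B$ and nonempty finite $F=\{x_{n_1},\dots,x_{n_m}\}\subset B$ with $n_1<\dots<n_m$, $\delta_F=\delta_{x_{n_1}}*\cdots*\delta_{x_{n_m}}$. An infinite discrete semiconvo (resp. hypergroup) $K$ is $0$-Ramsey, also called recurrent, if for every finite partition $K=\bigcup_{i=1}^rC_i$ there exist $i$ and an injective sequence $\langle x_n\rangle$ in $K\setminus\{e_K\}$ with range $B$ such that $\delta_F(C_i)>0$ for every nonempty finite $F\subset B$.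
   Formalization: A two-sided identity can fail to exist in G^H (affine action) and G/H (e.g. H not normal), so for the general claim and (i) associativity, infinitude and the 0-Ramsey property (avoiding e^H, resp. H) are proved always, and the full semiconvo claim whenever an identity exists. *)

(* Defs.v *)
From HB Require Export structures.
From mathcomp Require Export all_boot all_order all_algebra all_fingroup.
From mathcomp Require Export finmap.
From mathcomp Require Export boolp classical_sets functions cardinality reals.
From mathcomp.multinomials Require Export monalg.

Set Implicit Arguments.
Unset Strict Implicit.
Unset Printing Implicit Defensive.

Import Order.TTheory GRing.Theory Num.Theory.

Local Open Scope classical_set_scope.
Local Open Scope ring_scope.

(* The finitely supported (signed) measures on a discrete space K are the     *)
(* elements of {malg R[K]}: << k >> is the point mass at k, mu@_k is mu({k}). *)
Section Semiconvo.
Context {R : realType} {K : choiceType}.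
Implicit Types (conv : K -> K -> {malg R[K]}) (mu nu : {malg R[K]}) (e : K).

Definition mass mu (A : set K) : R := \sum_(k <- msupp mu | k \in A) mu@_k.

Definition is_prob mu : Prop :=
  (forall k, 0 <= mu@_k) /\ mass mu [set: K] = 1.

(* the bilinear extension of conv m n = delta_m * delta_n *)
Definition convm conv mu nu : {malg R[K]} :=
  \sum_(m <- msupp mu) \sum_(n <- msupp nu) (mu@_m * nu@_n) *: conv m n.

Definition semiconvo conv : Prop :=
  (forall m n, is_prob (conv m n)) /\ associative (convm conv).

Definition identity_element conv e : Prop :=
  forall m, conv m e = << m >> /\ conv e m = << m >>.

Definition discrete_semiconvo conv e : Prop :=
  semiconvo conv /\ identity_element conv e.

(* The axiom for inv on products says that the image of delta_m * delta_n     *)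
(* under inv is delta_(inv n) * delta_(inv m).                                *)
Definition discrete_hypergroup conv e (inv : K -> K) : Prop :=
  [/\ discrete_semiconvo conv e,
      involutive inv,
      forall m n k, (conv m n)@_(inv k) = (conv (inv n) (inv m))@_k &
      forall m n, (e \in msupp (conv m n)) = (n == inv m)].

(* delta_F for F = {x_n, x_n1, ..., x_nk}, where ns = [:: n1; ...; nk] and    *)
(* n < n1 < ... < nk.                                                         *)
Definition delta_seq conv (x : nat -> K) (n : nat) (ns : seq nat) :
    {malg R[K]} :=
  foldl (fun mu k => convm conv mu << x k >>) << x n >> ns.

(* x being injective, the nonempty finite subsets of its range correspond to  *)
(* the nonempty strictly increasing sequences of indices n :: ns.             *)
Definition zero_ramsey conv e : Prop :=
  forall (r : nat) (C : 'I_r -> set K),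
    partition [set: 'I_r] C [set: K] ->
    exists (i : 'I_r) (x : nat -> K),
      [/\ injective x,
          forall n, x n <> e &
          forall n ns, path ltn n ns -> 0 < mass (delta_seq conv x n ns) (C i)].

(* Recurrence with e in the role of e_K, but without requiring that e be a    *)
(* two-sided identity. The convolution on the orbit space of an affine action *)
(* is associative but need not have an identity: there is none for (Z, +)     *)
(* with Z/2 acting by x |-> 1 - x; and in G/H the coset H is a right identity *)
(* but is a left identity only when H is normal in G.                         *)
Definition recurrent conv e : Prop :=
  [/\ infinite_set [set: K], semiconvo conv & zero_ramsey conv e].

Definition recurrent_semiconvo conv e : Prop :=
  [/\ infinite_set [set: K], discrete_semiconvo conv e & zero_ramsey conv e].

Definition recurrent_hypergroup conv e (inv : K -> K) : Prop :=
  [/\ infinite_set [set: K], discrete_hypergroup conv e inv &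
      zero_ramsey conv e].

End Semiconvo.

(* The set {cls x : x in G}, for a map cls sending each x to its class.       *)
Section ClassSpace.
Context {G : choiceType} (cls : G -> set G).

Definition class_space : Type := set_type (range cls).
HB.instance Definition _ := Choice.on class_space.

Fact to_class_subproof x : cls x \in range cls.
Proof. exact/mem_set/imageT. Qed.

Definition to_class (x : G) : class_space := SigSub (to_class_subproof x).

Fact class_rep_subproof (A : class_space) : {x : G | cls x = val A}.
Proof. by have [x _ Ex] := cid2 (set_mem (valP A)); exists x. Qed.

Definition class_rep (A : class_space) : G := sval (class_rep_subproof A).

Lemma class_repE A : cls (class_rep A) = val A.
Proof. exact: svalP (class_rep_subproof A). Qed.

Lemma class_repK A : to_class (class_rep A) = A.
Proof. by apply: val_inj; rewrite /= class_repE. Qed.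

Lemma cls_class_rep x : cls (class_rep (to_class x)) = cls x.
Proof. exact: class_repE. Qed.

Lemma to_classP x y : to_class x = to_class y <-> cls x = cls y.
Proof. by split=> [/(congr1 val)|E] //; apply: val_inj. Qed.

End ClassSpace.

Lemma big_fset_reindex (T : choiceType) (V : nmodType) (H : {fset T})
    (g : T -> T) (F : T -> V) :
  {in H, forall s, g s \in H} -> {in H &, injective g} ->
  \sum_(s <- H) F (g s) = \sum_(s <- H) F s.
Proof.
move=> gH g_inj; rewrite -(big_map g xpredT); apply: perm_big.
have Ug : uniq (map g (enum_fset H)) by rewrite map_inj_in_uniq ?fset_uniq.
have sgH : {subset map g (enum_fset H) <= enum_fset H}.
  by move=> _ /mapP[s Hs ->]; apply: gH.
apply: uniq_perm; rewrite ?fset_uniq //.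
by case: (uniq_min_size Ug sgH) => //; rewrite size_map.
Qed.

Definition is_automorphism (G : groupType) (psi : G -> G) : Prop :=
  {morph psi : x y / (x * y)%g} /\ bijective psi.

Definition is_affine (G : groupType) (phi : G -> G) : Prop :=
  exists (psi : G -> G) (y : G),
    is_automorphism psi /\ forall x, phi x = (psi x * y)%g.

Definition is_affine_action (G : groupType) (H : finGroupType)
    (to : {action H &-> G}) : Prop :=
  forall s : H, is_affine (to^~ s).

Definition is_finite_subgroup (G : groupType) (H : {fset G}) : Prop :=
  group_closed [in H].

Definition is_finite_aut_subgroup (G : groupType) (H : {fset (G -> G)}) :
    Prop :=
  [/\ {in H, forall s, is_automorphism s},
      idfun \in H,
      {in H &, forall s t, s \o t \in H} &
      forall s, s \in H -> exists2 t, t \in H & cancel s t /\ cancel t s].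

(* The four convolutions are computed on class representatives; the lemmas    *)
(* named *E show that they do not depend on this choice.                      *)
Section Orbit.
Context (R : realType) (G : groupType) (H : finGroupType).
Variable to : {action H &-> G}.

Definition orbit_set (x : G) : set G := range (to x).

Definition orbit_space := class_space orbit_set.

Definition orb (x : G) : orbit_space := to_class orbit_set x.

Definition orbit_conv (A B : orbit_space) : {malg R[orbit_space]} :=
  (#|H|%:R ^+ 2)^-1 *:
    \sum_(s : H) \sum_(t : H)
      << orb (to (class_rep A) s * to (class_rep B) t)%g >>.

(* The action lemmas of MathComp are restricted to actions on finite types.   *)
Lemma orbit_actM x s t : to x (s * t)%g = to (to x s) t.
Proof. by case: (to) => f [fI fM]; apply: fM; rewrite inE. Qed.

Lemma orbit_act1 x : to x 1%g = x.
Proof.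
have inj_to : left_injective to by case: (to) => f [].
by apply: (inj_to 1%g); rewrite -orbit_actM mulg1.
Qed.

Lemma orbit_repP x : exists u, class_rep (orb x) = to x u.
Proof.
have : orbit_set (class_rep (orb x)) (class_rep (orb x)).
  by exists 1%g => //; rewrite orbit_act1.
by rewrite cls_class_rep => -[u _ <-]; exists u.
Qed.

Lemma orbit_convE x y :
  orbit_conv (orb x) (orb y) =
  (#|H|%:R ^+ 2)^-1 *:
    \sum_(s : H) \sum_(t : H) << orb (to x s * to y t)%g >>.
Proof.
rewrite /orbit_conv; case: (orbit_repP x) => u ->.
case: (orbit_repP y) => v ->; apply: (congr1 ( *:%R _)).
rewrite [RHS](reindex_inj (mulgI u)); apply: eq_bigr => s _.
rewrite [RHS](reindex_inj (mulgI v)); apply: eq_bigr => t _.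
by rewrite !orbit_actM.
Qed.

End Orbit.

Section Coset.
Context (R : realType) (G : groupType).
Variable H : {fset G}.

Definition coset_set (x : G) : set G := [set (x * s)%g | s in [set` H]].

Definition coset_space := class_space coset_set.

Definition lcos (x : G) : coset_space := to_class coset_set x.

Definition coset_conv (A B : coset_space) : {malg R[coset_space]} :=
  (#|` H|%:R)^-1 *:
    \sum_(s <- H) << lcos (class_rep A * s * class_rep B)%g >>.

Hypothesis subgH : is_finite_subgroup H.

Let H1 : 1%g \in H. Proof. by case: subgH. Qed.

Let HV x : x \in H -> x^-1%g \in H.
Proof. by move=> Hx; apply: (group_closedV subgH). Qed.

Let HM x y : x \in H -> y \in H -> (x * y)%g \in H.
Proof. by move=> Hx Hy; apply: (group_closedM subgH). Qed.

Let Hreindex (V : nmodType) a b (F : G -> V) : a \in H -> b \in H ->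
  \sum_(s <- H) F (a * s * b)%g = \sum_(s <- H) F s.
Proof.
move=> Ha Hb; apply: (big_fset_reindex (g := fun s => (a * s * b)%g)).
  by move=> s Hs; rewrite !HM.
by move=> s t _ _ /mulIg/mulgI.
Qed.

Lemma coset_repP x : exists2 h, h \in H & class_rep (lcos x) = (x * h)%g.
Proof.
have : coset_set (class_rep (lcos x)) (class_rep (lcos x)).
  by exists 1%g; rewrite ?mulg1.
by rewrite cls_class_rep => -[h Hh <-]; exists h.
Qed.

Lemma lcos_mulr x h : h \in H -> lcos (x * h)%g = lcos x.
Proof.
move=> Hh; apply/to_classP/seteqP; split=> _ [s Hs <-] /=.
  by exists (h * s)%g; rewrite /= ?HM ?mulgA.
by exists (h^-1 * s)%g; rewrite /= ?HM ?HV // mulgA mulgK.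
Qed.

Lemma coset_convE x y :
  coset_conv (lcos x) (lcos y) =
  (#|` H|%:R)^-1 *: \sum_(s <- H) << lcos (x * s * y)%g >>.
Proof.
rewrite /coset_conv; case: (coset_repP x) => a Ha ->.
case: (coset_repP y) => b Hb ->; apply: (congr1 ( *:%R _)).
rewrite -[RHS](Hreindex _ Ha H1); apply: eq_bigr => s _.
by rewrite mulg1 !mulgA lcos_mulr.
Qed.

Definition dcoset_set (x : G) : set G :=
  [set (s * x * t)%g | s in [set` H] & t in [set` H]].

Definition dcoset_space := class_space dcoset_set.

Definition dcos (x : G) : dcoset_space := to_class dcoset_set x.

Definition dcoset_conv (A B : dcoset_space) : {malg R[dcoset_space]} :=
  (#|` H|%:R)^-1 *:
    \sum_(t <- H) << dcos (class_rep A * t * class_rep B)%g >>.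

Definition dcoset_inv (A : dcoset_space) : dcoset_space :=
  dcos (class_rep A)^-1%g.

Lemma dcoset_repP x :
  exists a b, [/\ a \in H, b \in H & class_rep (dcos x) = (a * x * b)%g].
Proof.
have : dcoset_set (class_rep (dcos x)) (class_rep (dcos x)).
  by exists 1%g => //; exists 1%g; rewrite // mul1g mulg1.
by rewrite cls_class_rep => -[a Ha [b Hb <-]]; exists a, b.
Qed.

Lemma dcos_mul x a b : a \in H -> b \in H -> dcos (a * x * b)%g = dcos x.
Proof.
move=> Ha Hb; apply/to_classP/seteqP; split=> _ [s Hs [t Ht <-]] /=.
  exists (s * a)%g; first exact: HM.
  by exists (b * t)%g; rewrite /= ?HM ?mulgA.
exists (s * a^-1)%g; first by rewrite /= HM ?HV.
exists (b^-1 * t)%g; first by rewrite /= HM ?HV.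
by rewrite !mulgA mulgK mulgKV.
Qed.

Lemma dcoset_convE x y :
  dcoset_conv (dcos x) (dcos y) =
  (#|` H|%:R)^-1 *: \sum_(t <- H) << dcos (x * t * y)%g >>.
Proof.
rewrite /dcoset_conv; case: (dcoset_repP x) => a [b [Ha Hb ->]].
case: (dcoset_repP y) => c [d [Hc Hd ->]]; apply: (congr1 ( *:%R _)).
rewrite -[RHS](Hreindex _ Hb Hc); apply: eq_bigr => t _.
by rewrite -[in RHS](dcos_mul _ Ha Hd) !mulgA.
Qed.

Lemma dcoset_invE x : dcoset_inv (dcos x) = dcos x^-1%g.
Proof.
rewrite /dcoset_inv; case: (dcoset_repP x) => a [b [Ha Hb ->]].
by rewrite !invgM mulgA dcos_mul ?HV.
Qed.

End Coset.

Section AutOrbit.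
Context (R : realType) (G : groupType).
Variable H : {fset (G -> G)}.

Definition aut_orbit_set (x : G) : set G := [set s x | s in [set` H]].

Definition aut_orbit_space := class_space aut_orbit_set.

Definition aut_orb (x : G) : aut_orbit_space := to_class aut_orbit_set x.

Definition aut_orbit_conv (A B : aut_orbit_space) :
    {malg R[aut_orbit_space]} :=
  (#|` H|%:R)^-1 *:
    \sum_(s <- H) << aut_orb (s (class_rep A) * class_rep B)%g >>.

Definition aut_orbit_inv (A : aut_orbit_space) : aut_orbit_space :=
  aut_orb (class_rep A)^-1%g.

Hypothesis subgH : is_finite_aut_subgroup H.

Let autM s : s \in H -> {morph s : x y / (x * y)%g}.
Proof. by case: subgH => + _ _ _ Hs => /(_ s Hs)[]. Qed.

Let autV s x : s \in H -> s x^-1%g = (s x)^-1%g.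
Proof.
move=> Hs; have s1 : s 1%g = 1%g.
  by apply: (mulgI (s 1%g)); rewrite -autM // !mulg1.
by apply: (mulgI (s x)); rewrite -autM // !mulgV.
Qed.

Lemma aut_orbit_repP x : exists2 u, u \in H & class_rep (aut_orb x) = u x.
Proof.
have [_ H1 _ _] := subgH.
have : aut_orbit_set (class_rep (aut_orb x)) (class_rep (aut_orb x)).
  by exists idfun.
by rewrite cls_class_rep => -[u Hu <-]; exists u.
Qed.

Lemma aut_orb_act u x : u \in H -> aut_orb (u x) = aut_orb x.
Proof.
have [_ _ HM HV] := subgH.
move=> Hu; apply/to_classP/seteqP; split=> _ [s Hs <-] /=.
  by exists (s \o u) => //=; apply: HM.
have [v Hv [uK _]] := HV _ Hu.
by exists (s \o v) => /=; [apply: HM | rewrite uK].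
Qed.

Lemma aut_orbit_convE x y :
  aut_orbit_conv (aut_orb x) (aut_orb y) =
  (#|` H|%:R)^-1 *: \sum_(s <- H) << aut_orb (s x * y)%g >>.
Proof.
have [_ _ HM HV] := subgH.
rewrite /aut_orbit_conv.
move: (class_rep (aut_orb x)) (aut_orbit_repP x) => _ [u Hu ->].
move: (class_rep (aut_orb y)) (aut_orbit_repP y) => _ [v Hv ->].
apply: (congr1 ( *:%R _)).
have [u' Hu' [uK u'K]] := HV _ Hu; have [v' Hv' [vK v'K]] := HV _ Hv.
pose g s : G -> G := v' \o (s \o u).
have gH : {in H, forall s, g s \in H}.
  by move=> s Hs; apply: (HM v' (s \o u)) => //; apply: HM.
have g_inj : {in H &, injective g}.
  move=> s t _ _ E; apply: funext => z.
  have /(congr1 (fun f : G -> G => v (f (u' z)))) := E.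
  by rewrite /g /comp u'K !v'K.
rewrite -[RHS](big_fset_reindex _ gH g_inj); apply: eq_bigr => s Hs.
rewrite -(aut_orb_act (g s x * y)%g Hv) (autM Hv).
by rewrite /g /comp v'K.
Qed.

Lemma aut_orbit_invE x : aut_orbit_inv (aut_orb x) = aut_orb x^-1%g.
Proof.
rewrite /aut_orbit_inv; case: (aut_orbit_repP x) => u Hu ->.
by rewrite -autV // aut_orb_act.
Qed.

End AutOrbit.

Arguments orbit_conv R {G H} to A B.
Arguments coset_conv R {G} H A B.
Arguments dcoset_conv R {G} H A B.
Arguments dcoset_inv {G} H A.
Arguments aut_orbit_conv R {G} H A B.
Arguments aut_orbit_inv {G} H A.

(* Main.v *)
(* Hindman's theorem holds in every infinite group G: Zorn's lemma yields an
   idempotent ultrafilter p containing the cofinite sets, and the Galvin-Glazer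
   argument extracts from any set of p a sequence all of whose finite increasing
   products lie in that set. As classes (orbits, cosets, double cosets) are
   finite, the terms can be picked in pairwise distinct classes avoiding e.
   Pull a partition of the class space back to G: each of the four convolutions
   is an average of point masses, one of which sits at the class of the product
   xy, so delta_F charges the class of the product of the x_n, n in F. *)
Require Import Defs.
From mathcomp Require Import filter.

Set Implicit Arguments.
Unset Strict Implicit.
Unset Printing Implicit Defensive.

Import Order.TTheory GRing.Theory Num.Theory.

Local Open Scope classical_set_scope.
Local Open Scope ring_scope.

(** * Idempotent ultrafilters on a semigroup *)

Section Ultrafilter.
Context {G : semigroupType}.
Implicit Types (F E : set_system G) (A B : set G).

(** On ultrafilters this is the product of the Stone-Cech compactification: A belongs to it when
    x^-1 A, the set of y with x y in A, is in [E] for [F]-many x. *)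
Definition filter_mul F E : set_system G :=
  [set A | F [set x | E [set y | A (x * y)%g]]].

Lemma filter_mulS F F' E E' : Filter F' ->
  F `<=` F' -> E `<=` E' -> filter_mul F E `<=` filter_mul F' E'.
Proof.
by move=> F'F sF sE A /sF; apply: filterS => x; apply: sE.
Qed.

Lemma filter_mul_proper F E :
  ProperFilter F -> ProperFilter E -> ProperFilter (filter_mul F E).
Proof.
move=> FF EF; rewrite /filter_mul; split; [|split].
- move=> /= H0; apply: (filter_not_empty F); apply: filterS H0 => x /=.
  exact: filter_not_empty.
- by rewrite /=; apply: filterE => x; apply: filterT.
- move=> A B /= FA FB; apply: filterS2 FA FB => x; exact: filterI.
- by move=> A B sAB /=; apply: filterS => x; apply: filterS => y; apply: sAB.
Qed.

Lemma filter_mulA F E D :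
  filter_mul F (filter_mul E D) = filter_mul (filter_mul F E) D.
Proof.
rewrite /filter_mul /=; apply/funext => A /=; congr F.
apply/funext => x /=; congr E; apply/funext => y /=; congr D.
by apply/funext => z /=; rewrite mulgA.
Qed.

Let subidem F0 F := [/\ ProperFilter F, F0 `<=` F & F `<=` filter_mul F F].

(* Filters F `<=` filter_mul F F play the role of the closed subsemigroups of
   the Stone-Cech compactification in Ellis' lemma. *)
Lemma maximal_subidempotent_filter F0 : subidem F0 F0 ->
  exists2 F, subidem F0 F & forall E, subidem F0 E -> F `<=` E -> E = F.
Proof.
move=> idF0.
(* The guard [F !=set0] admits the empty set, which is the union of the empty chain. *)
have [C CP Ctot|F [PF Fmax]] :=
  @Zorn_bigcup (set G) [set F | F !=set0 -> subidem F0 F].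
  have CF X A : C X -> X A -> subidem F0 X.
    by move=> CX XA; apply: CP => //; exists A.
  case=> A0 [X0 CX0 XA0]; have [X0F F0X0 _] := CF _ _ CX0 XA0.
  split; [split; [|split]| |].
  - by move=> [X CX X0']; have [/filter_not_empty] := CF _ _ CX X0'.
  - by exists X0 => //; apply: filterT.
  - move=> A B [X CX XA] [Y CY YB].
    have [XF _ _] := CF _ _ CX XA; have [YF _ _] := CF _ _ CY YB.
    have [sXY|sYX] := Ctot _ _ CX CY.
      by exists Y => //; apply: filterI => //; apply: sXY.
    by exists X => //; apply: filterI => //; apply: sYX.
  - move=> A B sAB [X CX XA]; have [XF _ _] := CF _ _ CX XA.
    by exists X => //; apply: filterS XA.
  - by move=> A /F0X0 X0A; exists X0.
  - move=> A [X CX XA]; have [XF _ /(_ _ XA)] := CF _ _ CX XA.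
    rewrite /filter_mul /= => XXA; exists X => //.
    by apply: filterS XXA => x XxA; exists X.
have F0nz : F !=set0.
  apply: contrapT => /set0P/negP/negPn/eqP F0'.
  have [F0F _ _] := idF0; apply: (Fmax F0) => //; rewrite F0'; split=> //.
  by move=> /(_ setT filterT).
exists F; first exact: PF.
move=> E idE sFE; apply: contrapT => nEF; apply: (Fmax E) => //.
by split=> // sEF; apply: nEF; apply/seteqP.
Qed.

(** Ellis' argument: [F] stands for a minimal closed subsemigroup S. For p in S, both S p and the
    set of q in S with q p = p are closed subsemigroups of S, hence equal to S. This puts every set
    of p into F p = F, so [F] is p. *)
Lemma maximal_subidempotent_ultra F0 F : subidem F0 F ->
  (forall E, subidem F0 E -> F `<=` E -> E = F) -> UltraFilter F.
Proof.
move=> [FF F0F FFF] Fmax.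
have [p [pU sFp]] := ultraFilterLemma FF.
(* A minimal closed subsemigroup S satisfies S * p = S for p in S. *)
have Fp : filter_mul F p = F.
  apply: Fmax; last first.
    by apply: subset_trans FFF _; apply: filter_mulS.
  have sFFp : F `<=` filter_mul F p.
    by apply: subset_trans FFF _; apply: filter_mulS.
  split; first exact: filter_mul_proper.
    exact: subset_trans sFFp.
  (* Since (F p)(F p) = (F p F) p, it suffices to multiply the inclusion of F in F p F by p on the
     right. *)
  rewrite filter_mulA.
  have sFFpF : F `<=` filter_mul (filter_mul F p) F.
    apply: subset_trans FFF _; apply: filter_mulS => //.
    exact: filter_mul_proper.
  have FpF : ProperFilter (filter_mul (filter_mul F p) F).
    by do 2!apply: filter_mul_proper.
  by apply: filter_mulS.
(* E corresponds to the closed subsemigroup of the q with q * p = p. *)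
pose star A : set G := [set x | p [set y | A (x * y)%g]].
pose E : set_system G :=
  [set B | exists2 A, p A & F [set x | star A x -> B x]].
have sFE : F `<=` E.
  by move=> A FA; exists setT; [exact: filterT | apply: filterS FA => x Ax _].
have EF : ProperFilter E.
  split; [|split].
  (* If [star A], with A in p, missed a set of F, then, p being ultra, the complement of A would lie
     in F p = F, hence in p. *)
  - case=> A pA FA; apply: (filter_not_empty p).
    suff /sFp pAC : F (~` A) by rewrite -(setICr A); apply: filterI.
    rewrite -Fp; apply: filterS FA => x nx.
    by have [/nx|] := in_ultra_setVsetC [set y | A (x * y)%g] pU.
  - by exists setT; [exact: filterT | apply: filterE].
  - move=> B B' [A pA FA] [A' pA' FA']; exists (A `&` A'); first exact: filterI.
    apply: filterS2 FA FA' => x xB xB' xAA'.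
    by split; [apply: xB|apply: xB']; apply: filterS xAA' => y [].
  - move=> B B' sBB' [A pA FA]; exists A => //.
    by apply: filterS FA => x xB /xB/sBB'.
have EE : E = F.
  apply: Fmax => //; split=> //; first exact: subset_trans sFE.
  move=> B [A pA FA].
  (* This is the closure of the set of q with q p = p under products: for x in [star A], the set
     x^-1 A is again in p and is the witness for the inner [E]. *)
  have EstarA : filter_mul E E (star A).
    exists A => //; apply: filterE => x xA.
    exists [set y | A (x * y)%g] => //; apply: filterE => y.
    by rewrite /star /=; under eq_fun do rewrite mulgA.
  have EEF : ProperFilter (filter_mul E E) by exact: filter_mul_proper.
  have : filter_mul E E [set x | star A x -> B x].
    by apply: (filter_mulS _ sFE sFE); apply: FFF.
  by apply: filterS2 EstarA => x xA; apply.
have spF : p `<=` filter_mul F p.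
  move=> A pA; have : E (star A) by exists A => //; apply: filterE => x xA.
  by rewrite EE.
by rewrite (_ : F = p) //; apply/seteqP; split=> //; rewrite -[X in _ `<=` X]Fp.
Qed.

(** For an ultrafilter, inclusion in its square amounts to idempotence, the square being a proper
    filter. *)
Lemma idempotent_ultrafilter F : ProperFilter F -> F `<=` filter_mul F F ->
  exists p : set_system G, [/\ UltraFilter p, F `<=` p & p `<=` filter_mul p p].
Proof.
move=> FF FFF.
have idF : subidem F F by split.
have [p idp pmax] := maximal_subidempotent_filter idF.
have [_ Fp pp] := idp; exists p; split=> //.
exact: maximal_subidempotent_ultra idp pmax.
Qed.
End Ultrafilter.

(** * Hindman's theorem along a map with finite fibres *)

Section Hindman.
Context {G : groupType} {K : Type} (cls : G -> K).
Hypothesis cls_fin : forall k, finite_set (cls @^-1` [set k]).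
Hypothesis Ginf : infinite_set [set: G].

Let frechet_mul :
  @frechet_filter G `<=` filter_mul (@frechet_filter G) (@frechet_filter G).
Proof.
have FF := frechet_properfilter Ginf.
move=> A fA; rewrite /filter_mul /=; apply: filterE => x.
rewrite /frechet_filter /=.
apply: (sub_finite_set _ (finite_image (fun y => x^-1 * y)%g fA)) => y nAxy.
by exists (x * y)%g => //; rewrite mulKg.
Qed.

Lemma hindman (e : K) (r : nat) (C : 'I_r -> set K) :
  (forall k, exists i, C i k) ->
  exists (i : 'I_r) (x : nat -> G),
    [/\ injective (cls \o x), forall n, cls (x n) <> e &
      forall n ns, path ltn n ns ->
        C i (cls (foldl (fun g k => g * x k)%g (x n) ns))].
Proof.
move=> coverC.
have FF := frechet_properfilter Ginf.
have [p [pU cofp pp]] := idempotent_ultrafilter FF frechet_mul.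
have pcls k : p [set y | cls y <> k].
  by apply: cofp; rewrite /frechet_filter /= setCK; exact: cls_fin.
have [i pC] : exists i, p (cls @^-1` C i).
  apply: contrapT => /forallNP npC.
  have /filter_forall H : forall i, p (~` (cls @^-1` C i)).
    by move=> i; have [|] := in_ultra_setVsetC (cls @^-1` C i) pU => // /npC.
  apply: (filter_not_empty p); apply: filterS H => y nC.
  by have [i /nC] := coverC (cls y).
(* A set A of p is also in p p, so p-many x satisfy x^-1 A in p; one of them is taken in A. *)
have pick (A : {A | p A}) : {x | sval A x /\ p [set y | sval A (x * y)%g]}.
  case: A => A pA; apply: cid; exact: (filter_ex (filterI pA (pp _ pA))).
(* The next set is A cut down to x^-1 A and deprived of the class of x: left multiplication by x
   sends it into A, and later terms fall in new classes. *)
have pnext (A : {A | p A}) : p (sval A `&`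
    [set y | sval A (sval (pick A) * y)%g /\ cls y <> cls (sval (pick A))]).
  apply: filterI (svalP A) _.
  by apply: filterI (pcls _); have [] := svalP (pick A).
pose next (A : {A | p A}) : {A | p A} := exist p _ (pnext A).
have pA0 : p (cls @^-1` C i `&` [set y | cls y <> e]) by exact: filterI.
pose A n := iter n next (exist p _ pA0).
pose x n := sval (pick (A n)).
have A_anti m n : (m <= n)%N -> sval (A n) `<=` sval (A m).
  elim: n => [|n IHn]; first by rewrite leqn0 => /eqP->.
  rewrite leq_eqVlt => /orP[/eqP->//|/IHn]; apply: subset_trans.
  by move=> y [].
have xA n : sval (A n) (x n) by have [] := svalP (pick (A n)).
have xnext m n : (m < n)%N ->
    sval (A n) `<=` [set y | sval (A m) (x m * y)%g /\ cls y <> cls (x m)].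
  by move=> /A_anti sAnm y /sAnm[_ []].
exists i, x; split.
- have neq m n : (m < n)%N -> cls (x n) <> cls (x m).
    by move=> /xnext/(_ _ (xA n))[].
  move=> m n /= E; have [/neq|/neq|] // := ltngtP m n; first by rewrite E.
- by move=> n; have [] := A_anti _ _ (leq0n n) _ (xA n).
- have foldlM a b ns : foldl (fun g k => g * x k)%g (a * b)%g ns =
      (a * foldl (fun g k => g * x k) b ns)%g.
    by elim: ns b => //= k ns IHns b; rewrite -mulgA IHns.
  (* Products are built from the right: the tail starting at k > n lies in [A k], so by [xnext] left
     multiplication by [x n] brings it into [A n]. *)
  suff prodA n ns : path ltn n ns ->
      sval (A n) (foldl (fun g k => g * x k)%g (x n) ns).
    by move=> n ns /prodA/(A_anti _ _ (leq0n n))[].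
  elim: ns n => [|k ns IHns] n /=; first by move=> _; exact: xA.
  by move=> /andP[ltnk /IHns]; rewrite foldlM => /(xnext _ _ ltnk)[].
Qed.

End Hindman.

(** * Linear extension from point masses, and convolution of measures *)

Section MalgLift.
Context {R : idomainType} {K : choiceType}.

(** The integral of [f] against [mu]. *)
Definition malg_lift (V : lmodType R) (f : K -> V) (mu : {malg R[K]}) : V :=
  \sum_(k <- msupp mu) mu@_k *: f k.

Section Linear.
Context {V : lmodType R} (f : K -> V).

(** Supports change under sums; a common finite superset allows linearity to be checked term by
    term. *)
Lemma malg_liftEw (d : {fset K}) (mu : {malg R[K]}) :
  (msupp mu `<=` d)%fset -> malg_lift f mu = \sum_(k <- d) mu@_k *: f k.
Proof.
move=> sd; apply: big_fset_incl => // k _ /mcoeff_outdom ->.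
by rewrite scale0r.
Qed.

Lemma malg_lift_is_linear : linear (malg_lift f).
Proof.
move=> c mu nu; pose d := (msupp mu `|` msupp nu)%fset.
have sd : (msupp (c *: mu + nu) `<=` d)%fset.
  apply: fsubset_trans (msuppD_le _ _) _.
  by apply: fsetUSS => //; apply: msuppZ_le.
rewrite (malg_liftEw sd) (malg_liftEw (fsubsetUl _ (msupp nu))).
rewrite (malg_liftEw (fsubsetUr (msupp mu) _)) scaler_sumr -big_split /=.
by apply: eq_bigr => k _; rewrite mcoeffD mcoeffZ scalerDl scalerA.
Qed.

HB.instance Definition _ :=
  GRing.isLinear.Build R {malg R[K]} V _ (malg_lift f) malg_lift_is_linear.

Lemma malg_liftU k : malg_lift f << k >> = f k.
Proof. by rewrite (malg_liftEw msuppU_le) big_seq_fset1 mcoeffUU scale1r. Qed.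

End Linear.

Lemma malg_lift_comp (V W : lmodType R) (f : K -> V) (g : {linear V -> W}) mu :
  g (malg_lift f mu) = malg_lift (g \o f) mu.
Proof. by rewrite linear_sum; apply: eq_bigr => k _; rewrite linearZ. Qed.

(** Fubini's theorem for finitely supported measures. *)
Lemma malg_liftC (V : lmodType R) (f : K -> K -> V) mu nu :
  malg_lift (fun m => malg_lift (f m) nu) mu =
  malg_lift (fun n => malg_lift (f^~ n) mu) nu.
Proof.
rewrite /malg_lift; under eq_bigr do rewrite scaler_sumr.
rewrite exchange_big; apply: eq_bigr => n _; rewrite scaler_sumr.
by apply: eq_bigr => m _; rewrite !scalerA mulrC.
Qed.

Lemma eq_malg_lift (V : lmodType R) (f g : K -> V) mu :
  f =1 g -> malg_lift f mu = malg_lift g mu.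
Proof. by move=> fg; apply: eq_bigr => k _; rewrite fg. Qed.

End MalgLift.

Section Convm.
Context {R : realType} {K : choiceType} (conv : K -> K -> {malg R[K]}).

Lemma convm_lift mu nu :
  convm conv mu nu = malg_lift (fun m => malg_lift (conv m) nu) mu.
Proof.
apply: eq_bigr => m _; rewrite scaler_sumr; apply: eq_bigr => n _.
by rewrite scalerA.
Qed.

(** Both sides of associativity are trilinear, so point masses suffice; the hypothesis is delta_m *
    (delta_n * delta_k) = (delta_m * delta_n) * delta_k. *)
Lemma convmA :
  (forall m n k,
    malg_lift (conv m) (conv n k) = malg_lift (conv^~ k) (conv m n)) ->
  associative (convm conv).
Proof.
move=> convA a b c; rewrite !convm_lift.
rewrite (malg_lift_comp _ (malg_lift _)); apply: eq_malg_lift => m /=.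
rewrite !malg_lift_comp; apply: eq_malg_lift => n /=.
rewrite malg_lift_comp malg_liftC.
by apply: eq_malg_lift => k /=; rewrite convA.
Qed.

Lemma mass_gt0 (mu : {malg R[K]}) (A : set K) k :
  (forall j, 0 <= mu@_j) -> A k -> 0 < mu@_k -> 0 < mass mu A.
Proof.
move=> mu0 Ak muk; have ks : k \in msupp mu by rewrite -mcoeff_neq0 gt_eqF.
rewrite /mass big_mkcond (big_fsetD1 k) //= mem_set //.
by apply: ltr_pwDl => //; apply: sumr_ge0 => j _; case: ifP.
Qed.

Lemma mass_setT (mu : {malg R[K]}) :
  mass mu [set: K] = malg_lift (fun=> 1 : R^o) mu.
Proof.
rewrite /mass big_mkcond; apply: eq_bigr => k _.
by rewrite in_setT; exact/esym/mulr1.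
Qed.

End Convm.

(** * Convolutions averaging the classes of [f s x y] over the indices [s] in [S] *)

Section AverageConv.
Context {R : realType} {G : groupType} {K : choiceType} {I : eqType}.
Context (conv : K -> K -> {malg R[K]}) (cls : G -> K).
Context (S : seq I) (f : I -> G -> G -> G).
Hypothesis cls_surj : forall k, exists g, cls g = k.
Hypothesis convE : forall x y, conv (cls x) (cls y) =
  (size S)%:R^-1 *: \sum_(s <- S) << cls (f s x y) >>.
Hypothesis S_neq0 : S != [::].

Let c_gt0 : 0 < (size S)%:R^-1 :> R.
Proof. by rewrite invr_gt0 ltr0n lt0n size_eq0. Qed.

Lemma average_conv_ge0 m n k : 0 <= (conv m n)@_k.
Proof.
have [x <-] := cls_surj m; have [y <-] := cls_surj n.
rewrite convE mcoeffZ raddf_sum mulr_ge0 ?(ltW c_gt0) //=.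
by apply: sumr_ge0 => s _; rewrite mcoeffU ler0n.
Qed.

Lemma average_conv_mem x y s : s \in S ->
  0 < (conv (cls x) (cls y))@_(cls (f s x y)).
Proof.
move=> Ss; rewrite convE mcoeffZ raddf_sum mulr_gt0 //= (big_rem s) //=.
rewrite mcoeffU eqxx ltr_pwDl ?ltr01 //.
by apply: sumr_ge0 => t _; rewrite mcoeffU ler0n.
Qed.

(** The normalising factor occurs twice on each side of associativity, so only the double sums of
    classes remain to be compared. *)
Lemma average_conv_semiconvo :
  (forall x y z, \sum_(s <- S) \sum_(t <- S) << cls (f s x (f t y z)) >> =
    \sum_(s <- S) \sum_(t <- S) << cls (f t (f s x y) z) >> :> {malg R[K]}) ->
  semiconvo conv.
Proof.
move=> fA; split.
  move=> m n; split; first exact: average_conv_ge0.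
  have [x <-] := cls_surj m; have [y <-] := cls_surj n.
  rewrite mass_setT convE linearZ linear_sum /=.
  under eq_bigr do rewrite malg_liftU.
  rewrite big_const_seq count_predT iter_addr addr0.
  by apply: mulVf; rewrite pnatr_eq0 size_eq0.
apply: convmA => m n k.
have [x <-] := cls_surj m; have [y <-] := cls_surj n; have [z <-] := cls_surj k.
rewrite !convE !linearZ !linear_sum /=; congr (_ *: _).
under eq_bigr do rewrite malg_liftU convE.
under [RHS]eq_bigr do rewrite malg_liftU convE.
by rewrite -!scaler_sumr exchange_big fA.
Qed.

(** The index [s0] gives the class of x y positive weight. Induction along F carries nonnegativity
    of all weights together with positivity at the class of the group product, so nothing can
    cancel. *)
Lemma average_conv_zero_ramsey s0 e : s0 \in S ->
  (forall x y, cls (f s0 x y) = cls (x * y)%g) ->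
  infinite_set [set: G] -> (forall k, finite_set (cls @^-1` [set k])) ->
  zero_ramsey conv e.
Proof.
move=> Ss0 fs0 Ginf cls_fin r C [coverC _ _].
have [k|i [x [xinj xe xC]]] := hindman cls_fin Ginf e (C := C).
  have : (cover [set: 'I_r] C) k by rewrite coverC.
  by case=> i _; exists i.
exists i, (cls \o x); split=> // n ns /xC; set g := foldl _ _ _ => Cg.
suff [mu0 mug] : (forall j, 0 <= (delta_seq conv (cls \o x) n ns)@_j) /\
    0 < (delta_seq conv (cls \o x) n ns)@_(cls g).
  exact: mass_gt0 mug.
rewrite {xC Cg}/g /delta_seq /=.
have : (forall j, 0 <= (<< cls (x n) >> : {malg R[K]})@_j) /\
    0 < (<< cls (x n) >> : {malg R[K]})@_(cls (x n)).
  by rewrite mcoeffUU; split=> // j; rewrite mcoeffU ler0n.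
elim: ns (x n) (<< _ >>) => //= k ns IHns h mu [mu0 muh].
apply: IHns.
have convmE j : (convm conv mu << cls (x k) >>)@_j =
    \sum_(m <- msupp mu) mu@_m * (conv m (cls (x k)))@_j.
  rewrite convm_lift (eq_malg_lift _ (fun m => malg_liftU (conv m) _)).
  by rewrite raddf_sum; apply: eq_bigr => m _; exact: mcoeffZ.
have term_ge0 j m : 0 <= mu@_m * (conv m (cls (x k)))@_j.
  by rewrite mulr_ge0 ?average_conv_ge0.
split=> [j|]; rewrite convmE; first exact: sumr_ge0.
have hs : cls h \in msupp mu by rewrite -mcoeff_neq0 gt_eqF.
rewrite (big_fsetD1 (cls h)) //= ltr_pwDl ?sumr_ge0 // mulr_gt0 //.
by rewrite -fs0 average_conv_mem.
Qed.

Lemma average_conv_cst x y k : {in S, forall s, cls (f s x y) = k} ->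
  conv (cls x) (cls y) = << k >>.
Proof.
move=> fk; rewrite convE; under eq_big_seq => s Ss do rewrite fk //.
rewrite big_const_seq count_predT iter_addr addr0 -scaler_nat scalerA.
by rewrite mulVf ?scale1r // pnatr_eq0 size_eq0.
Qed.

Lemma average_conv_identity :
  (forall x, {in S, forall s, cls (f s x 1%g) = cls x}) ->
  (forall x, {in S, forall s, cls (f s 1%g x) = cls x}) ->
  identity_element conv (cls 1%g).
Proof.
move=> fx1 f1x m; have [x <-] := cls_surj m.
by split; apply: average_conv_cst.
Qed.

Lemma average_conv_msupp x y k :
  (k \in msupp (conv (cls x) (cls y))) = has (fun s => cls (f s x y) == k) S.
Proof.
apply/idP/hasP => [|[s Ss /eqP <-]]; last first.
  by rewrite -mcoeff_neq0 gt_eqF ?average_conv_mem.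
apply: contraTP => nk; rewrite -mcoeff_eq0 convE mcoeffZ raddf_sum /=.
rewrite big1_seq ?mulr0 // => s /= Ss; rewrite mcoeffU.
by case: eqP => // fk; case: nk; exists s => //; apply/eqP.
Qed.

Lemma average_conv_hypergroup (inv : K -> K) :
  semiconvo conv -> identity_element conv (cls 1%g) ->
  (forall x, inv (cls x) = cls x^-1%g) ->
  (forall x y, \sum_(s <- S) << inv (cls (f s x y)) >> =
    \sum_(s <- S) << cls (f s y^-1%g x^-1%g) >> :> {malg R[K]}) ->
  (forall x y, has (fun s => cls (f s x y) == cls 1%g) S =
    (cls y == cls x^-1%g)) ->
  discrete_hypergroup conv (cls 1%g) inv.
Proof.
move=> convA conv1 invE finv f1.
have invK : involutive inv.
  by move=> m; have [x <-] := cls_surj m; rewrite !invE invgK.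
split=> // m n; have [x <-] := cls_surj m; have [y <-] := cls_surj n.
  move=> k; rewrite !invE !convE !mcoeffZ -finv !raddf_sum /=.
  congr (_ * _); apply: eq_bigr => s _.
  by rewrite !mcoeffU (inv_eq invK).
by rewrite average_conv_msupp invE f1.
Qed.

End AverageConv.

(** The partition into a single cell already yields an injective sequence in K. *)
Lemma zero_ramsey_infinite (R : realType) (K : choiceType)
    (conv : K -> K -> {malg R[K]}) e :
  zero_ramsey conv e -> infinite_set [set: K].
Proof.
move=> /(_ 1%N (fun=> setT))[].
  split; first by apply/seteqP; split=> // k _; exists ord0.
    by move=> i j _ _ _; rewrite !ord1.
  by move=> i _; exists e.
move=> _ [x [xinj _ _]]; move=> Kfin; apply: infinite_nat.
by rewrite -(preimage_setT x); apply: finite_preimage Kfin => m n _ _ /xinj.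
Qed.

(** * Fibres of the class map *)

Section ClassFibers.
Context {G : choiceType} (cls : G -> set G).

Lemma to_class_surj (A : class_space cls) : exists x, to_class cls x = A.
Proof. by exists (class_rep A); exact: class_repK. Qed.

Lemma to_class_fiber_finite :
  (forall x, finite_set (cls x)) -> (forall x, cls x x) ->
  forall A, finite_set (to_class cls @^-1` [set A]).
Proof.
move=> cls_fin cls_refl A; rewrite -(class_repK A).
apply: sub_finite_set (cls_fin (class_rep A)) => y /= /to_classP <-.
exact: cls_refl.
Qed.

End ClassFibers.

(** * Orbits of affine actions *)

Section OrbitRecurrent.
Context (R : realType) (G : groupType) (H : finGroupType).
Variable to : {action H &-> G}.

Let f (u : H * H) (x y : G) := (to x u.1 * to y u.2)%g.
Let S := index_enum (H * H)%type.

Let size_S : size S = (#|H| ^ 2)%N.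
Proof.
by rewrite /S [index_enum _]unlock -enumT -cardT card_prod expnS expn1.
Qed.

Let S_neq0 : S != [::].
Proof.
apply/eqP => S0.
by have := mem_index_enum ((1, 1)%g : H * H); rewrite -/S S0.
Qed.

Let orb_surj (A : orbit_space to) : exists x, orb to x = A.
Proof. exact: to_class_surj. Qed.

Let orbit_convS x y : orbit_conv R to (orb to x) (orb to y) =
  (size S)%:R^-1 *: \sum_(u <- S) << orb to (f u x y) >>.
Proof.
rewrite orbit_convE (pair_bigA _ (fun s t => << orb to (to x s * to y t)%g >>)).
by rewrite size_S natrX.
Qed.

(** Writing x^u = psi(x) z gives 1^u = z, so (x y)^u = psi(x) psi(y) z = x^u z^-1 y^u. *)
Lemma affine_actM x y u : is_affine_action to ->
  to (x * y)%g u = (to x u * (to 1 u)^-1 * to y u)%g.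
Proof.
move=> /(_ u)[psi [z [[psiM _] toE]]]; rewrite !toE psiM.
have psi1 : psi 1%g = 1%g by apply: (mulgI (psi 1%g)); rewrite -psiM !mulg1.
by rewrite psi1 mul1g mulgK mulgA.
Qed.

Lemma orb_act x u : orb to (to x u) = orb to x.
Proof.
apply/to_classP/seteqP; split=> _ [v _ <-].
  by exists (u * v)%g => //; rewrite orbit_actM.
by exists (u^-1 * v)%g => //; rewrite -orbit_actM mulKVg.
Qed.

Lemma orbit_conv_semiconvo : is_affine_action to -> semiconvo (orbit_conv R to).
Proof.
move=> affH; apply: (average_conv_semiconvo orb_surj orbit_convS S_neq0).
move=> x y z.
(* With e_u := 1^u, acting by u^-1 inside the orbit on the left, and expanding
   the affine map on the right, turns both sides into the sum of the orbits of
   x^a * e_u^-1 * y^b * z^c. *)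
pose N a u b c : {malg R[orbit_space to]} :=
  << orb to (to x a * (to 1 u)^-1 * to y b * to z c)%g >>.
transitivity (\sum_(u : H) \sum_(a : H) \sum_(b : H) \sum_(c : H) N a u b c).
  rewrite -[LHS](pair_bigA _ (fun a u =>
    \sum_(t : H * H) << orb to (f (a, u) x (f t y z)) >>)).
  (* With w = y^b z^c and v = u^-1, the element x^a w^u has the same orbit as (x^a w^u)^v = x^(a v)
     e_v^-1 w; hence the substitutions u -> u^-1 and a -> a u^-1 in the target sum. *)
  rewrite exchange_big [RHS](reindex_inj invg_inj); apply: eq_bigr => u _.
  rewrite [RHS](reindex_inj (mulIg u^-1%g)); apply: eq_bigr => a _.
  rewrite pair_bigA; apply: eq_bigr => -[b c] _.
  apply: (congr1 (fun k => << k >>)); rewrite /f /=.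
  rewrite -(orb_act _ u^-1%g) affine_actM // -!orbit_actM mulgV.
  by rewrite orbit_act1 !mulgA.
rewrite -[RHS](pair_bigA _ (fun a b =>
  \sum_(t : H * H) << orb to (f t (f (a, b) x y) z) >>)) /=.
under [RHS]eq_bigr => a _ do under eq_bigr => b _ do
  rewrite -(pair_bigA _ (fun u c => << orb to (f (u, c) (f (a, b) x y) z) >>)).
under [RHS]eq_bigr => a _ do rewrite exchange_big.
rewrite [RHS]exchange_big; apply: eq_bigr => u _ /=.
(* Here (x^a y^b)^u = x^(a u) e_u^-1 y^(b u), so a and b are both shifted by u. *)
rewrite [LHS](reindex_inj (mulIg u)); apply: eq_bigr => a _.
rewrite [LHS](reindex_inj (mulIg u)); apply: eq_bigr => b _.
apply: eq_bigr => c _; apply: (congr1 (fun k => << k >>)).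
by rewrite /f /= affine_actM // -!orbit_actM.
Qed.

Lemma orbit_conv_zero_ramsey e : infinite_set [set: G] ->
  zero_ramsey (orbit_conv R to) e.
Proof.
move=> Ginf; apply: (average_conv_zero_ramsey (s0 := (1, 1)%g)
  orb_surj orbit_convS S_neq0 _ _ _ Ginf).
- exact: mem_index_enum.
- by move=> x y; rewrite /f /= !orbit_act1.
- apply: to_class_fiber_finite => x; last by exists 1%g; rewrite ?orbit_act1.
  by apply: finite_image; exact: finite_finset.
Qed.

End OrbitRecurrent.

Lemma enum_fset_neq0 (T : choiceType) (A : {fset T}) x :
  x \in A -> enum_fset A != [::].
Proof.
by move=> Ax; apply/eqP => A0; have : x \in enum_fset A by []; rewrite A0.
Qed.

(** * Cosets and double cosets *)

Section CosetRecurrent.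
Context (R : realType) (G : groupType) (H : {fset G}).
Hypothesis subgH : is_finite_subgroup H.

Let H1 : 1%g \in H. Proof. by case: subgH. Qed.

Let HV x : x \in H -> x^-1%g \in H.
Proof. by move=> Hx; apply: (group_closedV subgH). Qed.

Let HM x y : x \in H -> y \in H -> (x * y)%g \in H.
Proof. by move=> Hx Hy; apply: (group_closedM subgH). Qed.

Let H_neq0 : enum_fset H != [::].
Proof. exact: enum_fset_neq0 H1. Qed.

Let f (s x y : G) := (x * s * y)%g.

Let fA (K : choiceType) (cls : G -> K) x y z :
  \sum_(s <- H) \sum_(t <- H) << cls (f s x (f t y z)) >> =
  \sum_(s <- H) \sum_(t <- H) << cls (f t (f s x y) z) >> :> {malg R[K]}.
Proof. by apply: eq_bigr => s _; apply: eq_bigr => t _; rewrite /f !mulgA. Qed.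

Let lcos_surj (A : coset_space H) : exists x, lcos H x = A.
Proof. exact: to_class_surj. Qed.

Lemma coset_conv_semiconvo : semiconvo (coset_conv R H).
Proof.
exact: (average_conv_semiconvo lcos_surj (coset_convE R subgH) H_neq0 (fA _)).
Qed.

Lemma coset_conv_zero_ramsey e : infinite_set [set: G] ->
  zero_ramsey (coset_conv R H) e.
Proof.
move=> Ginf; apply: (average_conv_zero_ramsey
  lcos_surj (coset_convE R subgH) H_neq0 _ H1 _ Ginf).
- by move=> x y; rewrite mulg1.
- apply: to_class_fiber_finite => x; last by exists 1%g; rewrite ?mulg1.
  exact: finite_image.
Qed.

Lemma coset_conv1 A : coset_conv R H A (lcos H 1%g) = << A >>.
Proof.
have [x <-] := lcos_surj A.
apply: (average_conv_cst (coset_convE R subgH) H_neq0) => s Hs.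
by rewrite mulg1 lcos_mulr.
Qed.

Let dcos_surj (A : dcoset_space H) : exists x, dcos H x = A.
Proof. exact: to_class_surj. Qed.

Let dcos_refl x : dcoset_set H x x.
Proof. by exists 1%g => //; exists 1%g; rewrite // mul1g mulg1. Qed.

Lemma dcoset_conv_semiconvo : semiconvo (dcoset_conv R H).
Proof.
exact: (average_conv_semiconvo dcos_surj (dcoset_convE R subgH) H_neq0 (fA _)).
Qed.

Lemma dcoset_conv_zero_ramsey e : infinite_set [set: G] ->
  zero_ramsey (dcoset_conv R H) e.
Proof.
move=> Ginf; apply: (average_conv_zero_ramsey
  dcos_surj (dcoset_convE R subgH) H_neq0 _ H1 _ Ginf).
- by move=> x y; rewrite mulg1.
- apply: to_class_fiber_finite => x; last exact: dcos_refl.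
  exact: finite_image2.
Qed.

Lemma dcoset_conv_hypergroup :
  discrete_hypergroup (dcoset_conv R H) (dcos H 1%g) (dcoset_inv H).
Proof.
apply: (average_conv_hypergroup dcos_surj (dcoset_convE R subgH) H_neq0).
- exact: dcoset_conv_semiconvo.
- apply: (average_conv_identity dcos_surj (dcoset_convE R subgH) H_neq0).
    by move=> x s Hs; rewrite mulg1 -[(x * s)%g]mul1g mulgA dcos_mul.
  by move=> x s Hs; rewrite mul1g -[(s * x)%g]mulg1 dcos_mul.
- exact: dcoset_invE.
(* The substitution s -> s^-1 matches (x s y)^-1 = y^-1 s^-1 x^-1. *)
- move=> x y; rewrite -[RHS](big_fset_reindex (g := fun s => s^-1%g)).
  + apply: eq_bigr => s _; apply: (congr1 (fun k => << k >>)).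
    by rewrite dcoset_invE // !invgM mulgA.
  + exact: HV.
  + by move=> s t _ _; apply: invg_inj.
(* If x t y = a b with a, b in H, then y = t^-1 x^-1 (a b). Conversely, for y = a x^-1 b the choice
   t = a^-1 gives x t y = b. *)
- move=> x y; apply/hasP/eqP => [[t Ht /eqP/to_classP E]|/to_classP E].
    have : dcoset_set H 1%g (x * t * y)%g by rewrite -E.
    case=> a Ha [b Hb]; rewrite mulg1 => Eab.
    have -> : (y = t^-1 * x^-1 * (a * b))%g by rewrite Eab -!mulgA !mulKg.
    by rewrite dcos_mul ?HV ?HM.
  have : dcoset_set H x^-1%g y by rewrite -E.
  case=> a Ha [b Hb <-]; exists a^-1%g; first exact: HV.
  rewrite !mulgA mulgKV mulgV; apply/eqP.
  by rewrite -(dcos_mul subgH 1%g H1 Hb) !mul1g.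
Qed.

End CosetRecurrent.

(** * Orbits of a finite group of automorphisms *)

Section AutOrbitRecurrent.
Context (R : realType) (G : groupType) (H : {fset (G -> G)}).
Hypothesis subgH : is_finite_aut_subgroup H.

Let autM s : s \in H -> {morph s : x y / (x * y)%g}.
Proof. by case: subgH => + _ _ _ Hs => /(_ s Hs)[]. Qed.

Let aut1 s : s \in H -> s 1%g = 1%g.
Proof.
by move=> Hs; apply: (mulgI (s 1%g)); rewrite -autM // !mulg1.
Qed.

Let autV s x : s \in H -> s x^-1%g = (s x)^-1%g.
Proof.
by move=> Hs; apply: (mulgI (s x)); rewrite -autM // !mulgV aut1.
Qed.

Let H1 : idfun \in H. Proof. by case: subgH. Qed.

Let H_neq0 : enum_fset H != [::].
Proof. exact: enum_fset_neq0 H1. Qed.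

Let aut_orb_surj (A : aut_orbit_space H) : exists x, aut_orb H x = A.
Proof. exact: to_class_surj. Qed.

(** For fixed t, the map sending s to [t \o s] permutes H, and t(s(x) y) z = t(s(x)) t(y) z. *)
Lemma aut_orbit_conv_semiconvo : semiconvo (aut_orbit_conv R H).
Proof.
apply: (average_conv_semiconvo aut_orb_surj (aut_orbit_convE R subgH) H_neq0).
move=> x y z; have [_ _ HM HV] := subgH.
rewrite [LHS]exchange_big [RHS]exchange_big.
apply: eq_big_seq => t Ht; have [t' Ht' [tK t'K]] := HV _ Ht.
rewrite -[LHS](big_fset_reindex (g := fun s => t \o s)).
- apply: eq_big_seq => s Hs.
  by apply: (congr1 (fun k => << k >>)); rewrite (autM Ht) mulgA.
- by move=> s Hs; apply: HM.
- move=> s s' _ _ E; apply: funext => v.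
  by have /(congr1 (fun g => t' (g v))) := E; rewrite /= !tK.
Qed.

Lemma aut_orbit_conv_zero_ramsey e : infinite_set [set: G] ->
  zero_ramsey (aut_orbit_conv R H) e.
Proof.
move=> Ginf; apply: (average_conv_zero_ramsey
  aut_orb_surj (aut_orbit_convE R subgH) H_neq0 _ H1 _ Ginf) => //.
apply: to_class_fiber_finite => x; last by exists idfun.
exact: finite_image.
Qed.

Lemma aut_orbit_conv_hypergroup :
  discrete_hypergroup (aut_orbit_conv R H) (aut_orb H 1%g) (aut_orbit_inv H).
Proof.
have [_ _ HM HV] := subgH.
apply: (average_conv_hypergroup aut_orb_surj (aut_orbit_convE R subgH) H_neq0).
- exact: aut_orbit_conv_semiconvo.
- apply: (average_conv_identity aut_orb_surj (aut_orbit_convE R subgH) H_neq0).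
    by move=> x s Hs; rewrite mulg1 aut_orb_act.
  by move=> x s Hs; rewrite aut1 ?mul1g.
- exact: aut_orbit_invE.
(* On H the function [g] is inversion; outside H its value is arbitrary. Applying [g s] to (s(x)
   y)^-1 = y^-1 s(x^-1) gives (g s)(y^-1) x^-1 in the same orbit. *)
- have /choice[g gP] s : exists t : G -> G,
      s \in H -> [/\ t \in H, cancel s t & cancel t s].
    have [/HV[t Ht [sK tK]]|nHs] := boolP (s \in H); first by exists t.
    by exists s.
  move=> x y; rewrite -[RHS](big_fset_reindex (g := g)).
  + apply: eq_big_seq => s Hs; have [Hgs sK _] := gP _ Hs.
    apply: (congr1 (fun k => << k >>)).
    rewrite aut_orbit_invE // invgM -(autV x Hs).
    by rewrite -(aut_orb_act subgH _ Hgs) (autM Hgs) sK.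
  + by move=> s /gP[].
  + move=> s t /gP[_ _ gsK] /gP[_ tK _] E; apply: funext => v.
    by rewrite -[RHS]gsK E tK.
(* The orbit of 1 is {1}, so the condition reads s(x) y = 1, that is y = s(x^-1). *)
- move=> x y; apply/hasP/eqP => [[s Hs /eqP/to_classP E]|/to_classP E].
    have : aut_orbit_set H 1%g (s x * y)%g by rewrite -E; exists idfun.
    case=> t Ht; rewrite aut1 // => Exy.
    have -> : y = s x^-1%g by rewrite autV // -[y](mulKg (s x)) -Exy mulg1.
    by rewrite aut_orb_act.
  have : aut_orbit_set H x^-1%g y by rewrite -E; exists idfun.
  by case=> s Hs <-; exists s => //; rewrite autV // mulgV.
Qed.

End AutOrbitRecurrent.

Unset Implicit Arguments.

Theorem theorem4p8 (R : realType) (G : groupType)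
    (Ginf : infinite_set [set: G]) :
  [/\ forall (H : finGroupType) (to : {action H &-> G}),
        is_affine_action to ->
        recurrent (orbit_conv R to) (orb to 1%g) /\
        (forall e : orbit_space to,
          identity_element (orbit_conv R to) e ->
          recurrent_semiconvo (orbit_conv R to) e),
      forall H : {fset G},
        is_finite_subgroup H ->
        [/\ recurrent (coset_conv R H) (lcos H 1%g),
            forall A : coset_space H, coset_conv R H A (lcos H 1%g) = << A >> &
            forall e : coset_space H,
              identity_element (coset_conv R H) e ->
              recurrent_semiconvo (coset_conv R H) e],
      forall H : {fset G},
        is_finite_subgroup H ->
        recurrent_hypergroup (dcoset_conv R H) (dcos H 1%g) (dcoset_inv H) &
      forall H : {fset (G -> G)},
        is_finite_aut_subgroup H ->
        recurrent_hypergroup (aut_orbit_conv R H) (aut_orb H 1%g)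
          (aut_orbit_inv H)].
Proof.
split=> [H to affH|H subgH|H subgH|H subgH].
- have convA := orbit_conv_semiconvo R affH.
  (* The excluded point [e] stays arbitrary: it is the orbit of 1 in the first claim and a given
     identity in the second. *)
  have ramsey e : zero_ramsey (orbit_conv R to) e.
    exact: orbit_conv_zero_ramsey.
  have infK := zero_ramsey_infinite (ramsey (orb to 1%g)).
  by split=> [|e e1]; split=> //; split.
- have convA := coset_conv_semiconvo R subgH.
  have ramsey e : zero_ramsey (coset_conv R H) e.
    exact: coset_conv_zero_ramsey.
  have infK := zero_ramsey_infinite (ramsey (lcos H 1%g)).
  split=> [|A|e e1]; [by split | exact: coset_conv1 | by split=> //; split].
- have ramsey : zero_ramsey (dcoset_conv R H) (dcos H 1%g).
    exact: dcoset_conv_zero_ramsey.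
  split; [exact: zero_ramsey_infinite ramsey | | exact: ramsey].
  exact: dcoset_conv_hypergroup.
- have ramsey : zero_ramsey (aut_orbit_conv R H) (aut_orb H 1%g).
    exact: aut_orbit_conv_zero_ramsey.
  split; [exact: zero_ramsey_infinite ramsey | | exact: ramsey].
  exact: aut_orbit_conv_hypergroup.
Qed.
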